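(* Let $\mathcal{A}$ be a $\sigma$-structure and let both the direct power hierarchy $\{\Pi_\beta(\mathcal{A})\}$ and the cumulative power hierarchy of $\mathcal{A}$ be generated by the same family of index sets $\{I_\alpha\}_{\alpha\in\mathbf{On}}$. Then for every ordinal $\beta$, $\Pi_\beta(\mathcal{A})\cong\mathfrak{F}_\beta(\mathcal{A})$.
   Context: Index sets have cardinality greater than $1$. Cumulative power hierarchy: $\mathcal{F}_0(A)=A$, $\mathcal{F}_{\beta+1}(A)=\mathcal{F}_\beta(A)^{I_\beta}\cup\mathcal{F}_\beta(A)$ ($X^I$ = functions $I\to X$), $\mathcal{F}_\lambda(A)=\bigcup_{\alpha<\lambda}\mathcal{F}_\alpha(A)$ for limit $\lambda$; $\rho(a)$ is the least $\beta$ with $a\in\mathcal{F}_\beta(A)$; $\vartheta^\alpha_j(a)=a(j)$ if $\rho(a)\ge\alpha$ and $j\in\mathrm{dom}(a)$, else $a$. For each $n$-ary function symbol $F$ and relation symbol $R$: with $\delta=\max_i\rho(a_i)$, if $\delta=0$, $F_\beta,R_\beta$ agree with $\mathcal{A}$; if $\delta>0$, $F_\beta(a_1,\dots,a_n)$ is the unique $b$ with $\rho(b)=\delta$ and $b(j)=F_{\delta-1}(\vartheta^\delta_j(a_1),\dots,\vartheta^\delta_j(a_n))$ for all $j\in I_{\delta-1}$, and $R_\beta(a_1,\dots,a_n)$ iff $R_{\delta-1}(\vartheta^\delta_j(a_1),\dots,\vartheta^\delta_j(a_n))$ for all $j\in I_{\delta-1}$. Hereditary identity: $a\equiv_0 b$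 iff $a=b$; for $a,b\in\mathcal{F}_{\beta+1}(A)$ with $\delta=\max(\rho(a),\rho(b))$, $a\equiv_{\beta+1}b$ iff $\vartheta^\delta_j(a)\equiv_{\delta-1}\vartheta^\delta_j(b)$ for all $j\in I_{\delta-1}$ (when $\delta=0$ this means $a=b$); $\equiv_\lambda=\bigcup_{\alpha<\lambda}\equiv_\alpha$ for limit $\lambda$. This is an equivalence relation; $[a]$ denotes classes. $\mathfrak{F}_\beta(\mathcal{A})$ is the $\sigma$-structure on $\mathcal{F}_\beta(A)/\!\equiv_\beta$ with $F([x_1],\dots,[x_n])=[F_\beta(x_1,\dots,x_n)]$, each constant $c$ interpreted as $[c^{\mathcal{A}}]$, and $R([a_1],\dots,[a_n])$ iff there are $b_i\equiv_\beta a_i$ with $R_\beta(b_1,\dots,b_n)$. Direct power hierarchy: $\Pi_0(\mathcal{A})=\mathcal{A}$; $\Pi_{\beta+1}(\mathcal{A})=\Pi_\beta(\mathcal{A})^{I_\beta}$, the direct power (operations and relations pointwise, a relation holding iff it holds at every coordinate, constants as constant functions); for limit $\lambda$, $\Pi_\lambda(\mathcal{A})$ is the direct limit of the $\Pi_\alpha(\mathcal{A})$, $\alpha<\lambda$, along the embeddings $e^\beta_\alpha:\Pi_\alpha(\mathcal{A})\to\Pi_\beta(\mathcal{A})$ given by $e^\alpha_\alpha=\mathrm{id}$, $e^{\beta+1}_\alpha(x)=$ the constant function $I_\beta\to\{e^\beta_\alpha(x)\}$, and at limits the canonical maps into the direct limit.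
   Formalization: Functions in F_β(A)^{I_β} are labelled by their stage β (I_β is read as {β}×I_β); this is automatic if the index sets are pairwise distinct. Unlabelled, the claim fails, e.g. all I_β={0,1}, A a 2-element set, β=ω_1. Elements of A are urelements. *)

(* Defs.v *)
From HB Require Import structures.
From mathcomp Require Import all_boot all_order.
From mathcomp Require Import mathcomp_extra boolp classical_sets.

Set Implicit Arguments.
Unset Strict Implicit.
Unset Printing Implicit Defensive.

Import Order.TTheory.
Local Open Scope order_scope.
Local Open Scope classical_set_scope.

(** * First-order structures *)

Record signature := Signature {
  fsym : Type; farity : fsym -> nat;
  rsym : Type; rarity : rsym -> nat;
  csym : Type }.

Record structure (sg : signature) := Structure {
  carrier :> Type;
  sfun : forall f : fsym sg, ('I_(farity f) -> carrier) -> carrier;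
  srel : forall r : rsym sg, ('I_(rarity r) -> carrier) -> Prop;
  scst : csym sg -> carrier }.
Arguments sfun {sg} s f _.
Arguments srel {sg} s r _.
Arguments scst {sg} s c.

Section Morphisms.
Context {sg : signature}.

Definition homomorphism (S T : structure sg) (h : S -> T) : Prop :=
  [/\ forall f x, h (sfun S f x) = sfun T f (fun i => h (x i)),
      forall r x, srel S r x -> srel T r (fun i => h (x i)) &
      forall c, h (scst S c) = scst T c].

Definition isomorphism (S T : structure sg) (h : S -> T) : Prop :=
  [/\ bijective h,
      forall f x, h (sfun S f x) = sfun T f (fun i => h (x i)),
      forall r x, srel S r x <-> srel T r (fun i => h (x i)) &
      forall c, h (scst S c) = scst T c].

Definition isomorphic (S T : structure sg) : Prop :=
  exists h : S -> T, isomorphism h.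

Definition direct_power (S : structure sg) (K : Type) : structure sg :=
  @Structure sg (K -> S)
    (fun f x k => sfun S f (fun i => x i k))
    (fun r x => forall k, srel S r (fun i => x i k))
    (fun c _ => scst S c).

End Morphisms.

(** * Ordinals, as the elements of a well-ordered type *)

Definition well_ordered (d : Order.disp_t) (O : orderType d) : Prop :=
  well_founded (fun a b : O => a < b).

Section Ordinals.
Context {d : Order.disp_t} {O : orderType d}.
Implicit Types a b : O.

Definition is_zero a : Prop := forall b, a <= b.
Definition is_succ a b : Prop := a < b /\ forall c, a < c -> b <= c.
Definition is_limit a : Prop := ~ is_zero a /\ ~ exists b, is_succ b a.


Lemma ordinal_cases (b : O) :
  [\/ is_zero b, exists c, is_succ c b | is_limit b].
Proof.
case: (pselect (is_zero b)) => [?|nz]; first exact: Or31.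
case: (pselect (exists c, is_succ c b)) => [?|ns]; first exact: Or32.
exact: Or33.
Qed.

Hypothesis wfO : well_ordered O.

Lemma ordinal_min (P : O -> Prop) :
  (exists b, P b) -> exists2 b, P b & forall c, P c -> b <= c.
Proof.
case=> b; elim/(well_founded_ind wfO): b => b IH Pb.
case: (pselect (exists2 c, c < b & P c)) => [[c cb Pc]|nex].
  exact: IH cb Pc.
exists b => // c Pc; rewrite leNgt; apply/negP => cb; apply: nex; by exists c.
Qed.

Lemma is_succ_inj (b c c' : O) : is_succ b c -> is_succ b c' -> c = c'.
Proof.
by case=> bc hc [bc' hc']; apply/eqP; rewrite eq_le hc //= hc'.
Qed.

Lemma is_succ_lt (b b' c : O) : is_succ b b' -> c < b' -> c <= b.
Proof.
by case=> _ h cb; rewrite leNgt; apply/negP => /h; rewrite leNgt cb.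
Qed.

Lemma succ_exists (b c : O) : b < c -> exists2 b', is_succ b b' & b' <= c.
Proof.
move=> bc; have [|b' bb' hb'] := @ordinal_min (fun x => b < x).
  by exists c.
by exists b'; [split | exact: hb'].
Qed.

End Ordinals.

(** * The direct power hierarchy *)

Section DirectPowers.
Context {sg : signature} {d : Order.disp_t} {O : orderType d}.

Section DirectLimit.
Variables (P : O -> structure sg)
  (e : forall a b : O, a <= b -> P a -> P b) (lam : O).

Definition is_cocone (L : structure sg) (c : forall a, a < lam -> P a -> L) :
    Prop :=
  (forall a (ha : a < lam), homomorphism (c a ha)) /\
  (forall a b (ha : a < lam) (hb : b < lam) (hab : a <= b) (x : P a),
     c b hb (e hab x) = c a ha x).

Definition is_direct_limit (L : structure sg)
    (c : forall a, a < lam -> P a -> L) : Prop :=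
  is_cocone c /\
  forall (T : structure sg) (g : forall a, a < lam -> P a -> T),
    is_cocone g ->
    exists! h : L -> T,
      homomorphism h /\ forall a (ha : a < lam) (x : P a), h (c a ha x) = g a ha x.

End DirectLimit.

(* Direct limits are defined up to isomorphism only, and so is the hierarchy:
   any choice of structures and embeddings that obeys the recursion clauses up
   to isomorphism is one (see [direct_power_hierarchy_exists]). *)
Record direct_power_hierarchy (A : structure sg) (J : Type) (I : O -> set J) :=
  DirectPowerHierarchy {
  dpow :> O -> structure sg;
  demb : forall a b : O, a <= b -> dpow a -> dpow b;
  demb_id : forall a (haa : a <= a) (x : dpow a), demb haa x = x;
  dpow_zero : forall a, is_zero a -> isomorphic A (dpow a);
  dpow_succ : forall b b', is_succ b b' ->
    exists s : direct_power (dpow b) {j | I b j} -> dpow b',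
      isomorphism s /\
      forall a (hab : a <= b) (hab' : a <= b') (x : dpow a),
        demb hab' x = s (fun _ => demb hab x);
  dpow_limit : forall lam, is_limit lam ->
    is_direct_limit demb (fun a (ha : a < lam) => demb (ltW ha)) }.

End DirectPowers.

(** * The cumulative power hierarchy *)

Section CumulativePowers.
Context {sg : signature} (A : structure sg).
Context {d : Order.disp_t} {O : orderType d}.
Context {J : Type} (I : O -> set J).

(* The objects from which the hierarchy is built: elements of [A], taken as
   urelements (never functions), and functions with domain [I b]. A function on
   [I b] is labelled by [b], so that functions entering at different stages
   stay different even if the index sets coincide; this is what "assume that
   the index sets are pairwise distinct" achieves set-theoretically. Without
   it, [F_b(A)^(I b)] could be contained in [F_b(A)]: this happens at every
   limit [b] when all the [I b] are the same finite set, and the hierarchy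
   would stop growing at the first limit, unlike the direct powers. *)
Inductive pobj : Type :=
| Atom : A -> pobj
| Fun : forall b : O, ({j | I b j} -> pobj) -> pobj.

(* [cum b] is [F_b(A)]. *)
Inductive cum : O -> set pobj :=
| cum_zero b x : is_zero b -> cum b (Atom x)
| cum_succ_fun b b' (f : {j | I b j} -> pobj) :
    is_succ b b' -> (forall j, cum b (f j)) -> cum b' (Fun f)
| cum_succ_in b b' a : is_succ b b' -> cum b a -> cum b' a
| cum_limit lam b a : is_limit lam -> b < lam -> cum b a -> cum lam a.

Definition rank (a : pobj) (r : O) : Prop :=
  cum r a /\ forall b, cum b a -> r <= b.

Definition theta (al : O) (j : J) (a : pobj) : pobj :=
  match a with
  | Atom _ => a
  | Fun b f =>
      match pselect (exists2 r, rank a r & al <= r), pselect (I b j) with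
      | left _, left bj => f (exist _ j bj)
      | _, _ => a
      end
  end.

Definition max_rank n (a : 'I_n -> pobj) (r : O) : Prop :=
  (forall i, exists2 s, rank (a i) s & s <= r) /\ exists i, rank (a i) r.

(* [cum_fun f b] is the graph of the interpretation of [f] on [F_b(A)]. In the
   first clause all ranks are 0; the maximum of no ranks is 0 as well. *)
Inductive cum_fun (f : fsym sg) :
    O -> ('I_(farity f) -> pobj) -> pobj -> Prop :=
| cum_fun_zero b (x : 'I_(farity f) -> A) :
    cum_fun b (fun i => Atom (x i)) (Atom (sfun A f x))
| cum_fun_pos b c r (a : 'I_(farity f) -> pobj) (g : {j | I c j} -> pobj) :
    (forall i, cum b (a i)) -> max_rank a r -> is_succ c r ->
    rank (Fun g) r ->
    (forall j, cum_fun c (fun i => theta r (sval j) (a i)) (g j)) ->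
    cum_fun b a (Fun g).

Inductive cum_rel (R : rsym sg) : O -> ('I_(rarity R) -> pobj) -> Prop :=
| cum_rel_zero b (x : 'I_(rarity R) -> A) :
    srel A R x -> cum_rel b (fun i => Atom (x i))
| cum_rel_pos b c r (a : 'I_(rarity R) -> pobj) :
    (forall i, cum b (a i)) -> max_rank a r -> is_succ c r ->
    (forall j : {j | I c j}, cum_rel c (fun i => theta r (sval j) (a i))) ->
    cum_rel b a.

(* [hid b a1 a2] reads: [a1] and [a2] are hereditarily identical in [F_b(A)]. *)
Inductive hid : O -> pobj -> pobj -> Prop :=
| hid_zero b a : is_zero b -> cum b a -> hid b a a
| hid_succ_zero b b' z a :
    is_succ b b' -> is_zero z -> rank a z -> hid b' a a
| hid_succ_pos b b' c ra rb a1 a2 :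
    is_succ b b' -> cum b' a1 -> cum b' a2 ->
    rank a1 ra -> rank a2 rb -> is_succ c (Order.max ra rb) ->
    (forall j : {j | I c j},
       hid c (theta (Order.max ra rb) (sval j) a1)
             (theta (Order.max ra rb) (sval j) a2)) ->
    hid b' a1 a2
| hid_limit lam b a1 a2 : is_limit lam -> b < lam -> hid b a1 a2 ->
    hid lam a1 a2.

Definition hid_class (b : O) (a : pobj) : set pobj := [set a' | hid b a a'].

Definition cum_quot (b : O) : Type :=
  {C : set pobj | exists2 a, cum b a & C = hid_class b a}.

Definition to_quot b a (ha : cum b a) : cum_quot b :=
  exist _ (hid_class b a) (ex_intro2 _ _ a ha erefl).

Definition quot_repr b (q : cum_quot b) : pobj := s2val (cid2 (svalP q)).

Lemma cum_quot_repr b (q : cum_quot b) : cum b (quot_repr q).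
Proof. exact: s2valP. Qed.

Hypothesis wfO : well_ordered O.

Lemma cum_le (b c : O) a : b <= c -> cum b a -> cum c a.
Proof.
elim/(well_founded_ind wfO): c => c IH.
rewrite le_eqVlt => /orP[/eqP->//|bc ba].
case: (ordinal_cases c) => [cz|[c' cc']|cl].
- by move: (cz b); rewrite leNgt bc.
- apply: (cum_succ_in cc'); apply: IH => //; first by case: cc'.
  exact: is_succ_lt bc.
- exact: cum_limit cl bc ba.
Qed.

Lemma cum_Atom (b : O) x : cum b (Atom x).
Proof.
have [|z _ zP] := @ordinal_min _ _ wfO (fun=> True); first by exists b.
apply: (@cum_le z); first exact: zP.
by apply: cum_zero => c; apply: zP.
Qed.

Lemma Fun_inj (c : O) (f g : {j | I c j} -> pobj) : Fun f = Fun g -> f = g.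
Proof.
pose out a : {j | I c j} -> pobj := if a is Fun b h then
  if b =P c is ReflectT e then ecast b ({j | I b j} -> pobj) e h else f else f.
move=> /(congr1 out); rewrite /out; case: eqP => // e.
by rewrite (eq_irrelevance e erefl).
Qed.

Lemma cum_Fun_inv (b c : O) (f : {j | I c j} -> pobj) : cum b (Fun f) ->
  exists2 c', is_succ c c' & c' <= b /\ forall j, cum c (f j).
Proof.
move Ea: (Fun f) => a ba; elim: ba f Ea => {b a}.
- by [].
- move=> b b' g bb' hg _ f E.
  have e : c = b by case: E.
  by case: _ / e g bb' hg E => g bb' hg /Fun_inj ->; exists b'.
- move=> b b' a [bb' _] _ IH f /IH[c' cc' [c'b h]]; exists c' => //; split=> //.
  exact: le_trans c'b (ltW bb').
- move=> lam b a _ bl _ IH f /IH[c' cc' [c'b h]]; exists c' => //; split=> //.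
  exact: le_trans c'b (ltW bl).
Qed.

Lemma rank_inj a (r s : O) : rank a r -> rank a s -> r = s.
Proof.
by move=> [ra rmin] [sa smin]; apply/eqP; rewrite eq_le rmin //= smin.
Qed.

Lemma rank_Fun (c r : O) (f : {j | I c j} -> pobj) :
  is_succ c r -> (forall j, cum c (f j)) -> rank (Fun f) r.
Proof.
move=> cr hf; split; first exact: cum_succ_fun cr hf.
by move=> b /cum_Fun_inv[r' cr' [r'b _]]; rewrite (is_succ_inj cr cr').
Qed.

Lemma rank_Atom (x : A) (r : O) : rank (Atom x) r <-> is_zero r.
Proof.
split=> [[_ h] b|rz]; first by apply: h; exact: cum_Atom.
by split=> [|b _]; [exact: cum_Atom | exact: rz].
Qed.

Lemma theta_cum (c r : O) (j : {j | I c j}) a s :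
  is_succ c r -> rank a s -> s <= r -> cum c (theta r (sval j) a).
Proof.
move=> cr; case: a => [x|b f] as_ sr /=; first exact: cum_Atom.
have [s' bs' [_ fP]] := cum_Fun_inv as_.1.
have ss' := rank_inj as_ (rank_Fun bs' fP).
case: pselect => [[r' r'P rr']|nr]; last first.
  have : s < r by rewrite ltNge; apply/negP => rs; apply: nr; exists s.
  by move=> /(is_succ_lt cr) sc; apply: cum_le sc as_.1.
have e : s = r by apply/eqP; rewrite eq_le sr (rank_inj as_ r'P) rr'.
have {}e : b = c.
  subst s s'; apply/eqP; rewrite eq_le.
  by rewrite (is_succ_lt cr bs'.1) (is_succ_lt bs' cr.1).
subst b; case: pselect => [cj|]; first exact: fP.
by case; exact: (svalP j).
Qed.

Lemma cum_fun_total (f : fsym sg) (b : O) (a : 'I_(farity f) -> pobj) :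
  (forall i, cum b (a i)) -> exists2 a', cum b a' & cum_fun b a a'.
Proof.
elim/(well_founded_ind wfO): b a => b IH a ab.
case: (pselect (forall i, exists x, a i = Atom x)) => [/choice[x ax]|].
  have -> : a = fun i => Atom (x i) by apply: funext.
  by exists (Atom (sfun A f x)); [exact: cum_Atom | exact: cum_fun_zero].
move=> /existsNP[i0 i0P].
have /choice[s sP] : forall i, exists s, rank (a i) s.
  move=> i; move: (ab i); case: (a i) => [x|c g] ai.
    have [|z _ zP] := @ordinal_min _ _ wfO (fun=> True); first by exists b.
    by exists z; apply/rank_Atom => c; exact: zP.
  by have [s cs [_ gP]] := cum_Fun_inv ai; exists s; exact: rank_Fun.
pose m := [arg max_(i > i0) s i]%O.
have mP i : s i <= s m by rewrite /m; case: arg_maxP => // k _; exact.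
have amr : max_rank a (s m).
  by split; [move=> i; exists (s i) | exists m].
have [c cr] : exists c, is_succ c (s m).
  case E : (a m) => [x|c g]; last first.
    have := ab m; rewrite E => /cum_Fun_inv[s' cs' [_ gP]]; exists c.
    by have := sP m; rewrite E => /rank_inj/(_ (rank_Fun cs' gP)) ->.
  have mz : is_zero (s m) by apply/(rank_Atom x); rewrite -E.
  case E0 : (a i0) => [x0|c g]; first by case: i0P; exists x0.
  have := ab i0; rewrite E0 => /cum_Fun_inv[s' cs' [_ gP]]; exists c.
  have e : s i0 = s' by have := sP i0; rewrite E0 => /rank_inj; apply; exact: rank_Fun.
  by have := mP i0; rewrite e leNgt (le_lt_trans (mz c) cs'.1).
have mb : s m <= b by apply: (sP m).2.
have /choice[g gP] : forall j : {j | I c j}, exists a',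
    cum c a' /\ cum_fun c (fun i => theta (s m) (sval j) (a i)) a'.
  move=> j; have [||a' ca' fa'] := IH c _ (fun i => theta (s m) (sval j) (a i)).
  - exact: lt_le_trans cr.1 mb.
  - by move=> i; exact: theta_cum (mP i).
  - by exists a'.
have gr : rank (Fun g) (s m) by apply: rank_Fun => // j; exact: (gP j).1.
exists (Fun g); first exact: cum_le mb gr.1.
by apply: (cum_fun_pos ab amr cr gr) => j; exact: (gP j).2.
Qed.

Lemma max_rank_inj n (a : 'I_n -> pobj) (r s : O) :
  max_rank a r -> max_rank a s -> r = s.
Proof.
move=> [ra [i ri]] [sa [k sk]]; apply/eqP; rewrite eq_le.
have [s' /(rank_inj ri) <- ->] := sa i.
by have [r' /(rank_inj sk) <- ->] := ra k.
Qed.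

Lemma max_rank_Atom n (x : 'I_n -> A) (c r : O) :
  max_rank (fun i => Atom (x i)) r -> is_succ c r -> False.
Proof.
by move=> [_ [i /rank_Atom rz]] [cr _]; move: (rz c); rewrite leNgt cr.
Qed.

Lemma cum_fun_unique (f : fsym sg) (b : O) (a : 'I_(farity f) -> pobj) a1 a2 :
  cum_fun b a a1 -> cum_fun b a a2 -> a1 = a2.
Proof.
move=> h; elim: h a2 => {b a a1} [b x a2|b c r a g _ ar cr _ _ IH a2] h.
- move Ea: (fun i => Atom (x i)) h => a h.
  case: h Ea => [? y|? c r {}a g _ ar cr _ _] Ea.
    congr (Atom (sfun A f _)); apply: funext => i.
    by have := congr1 (fun h => h i) Ea => -[].
  by case: (max_rank_Atom (x := x) (r := r) (c := c)); rewrite ?Ea.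
- case: h ar IH => [? y|? c' r' {}a g' _ ar' cr' _ hg'] ar IH.
    by case: (max_rank_Atom ar cr).
  have e := max_rank_inj ar ar'; subst r'.
  have e : c = c'.
    by apply/eqP; rewrite eq_le (is_succ_lt cr' cr.1) (is_succ_lt cr cr'.1).
  subst c'; congr Fun; apply: funext => j; exact/IH/hg'.
Qed.

Definition cum_fun_val (f : fsym sg) (b : O) (q : 'I_(farity f) -> cum_quot b) :=
  cid2 (cum_fun_total (fun i => cum_quot_repr (q i))).

Definition cum_structure (b : O) : structure sg :=
  @Structure sg (cum_quot b)
    (fun f q => to_quot (s2valP (cum_fun_val q)))
    (fun R q => exists2 a, forall i, sval (q i) (a i) & cum_rel b a)
    (fun c => to_quot (cum_Atom b (scst A c))).

End CumulativePowers.

(** * Existence of the direct power hierarchy *)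

Section DirectPowersExist.
Context {sg : signature} (A : structure sg).
Context {d : Order.disp_t} {O : orderType d}.
Context {J : Type} (I : O -> set J).
Hypothesis wfO : well_ordered O.
Hypothesis I_gt1 : forall b, exists j k, [/\ I b j, I b k & j <> k].

Local Notation env := (forall b, {j | I b j}).

(* An iterated power is realized by functions to [A] of one index in each
   [I c], [c < b], that read their arguments in decreasing order of [c]. *)
Inductive dfun : O -> (env -> A) -> Prop :=
| dfun_cst b x : dfun b (fun=> x)
| dfun_read b c (F : {j | I c j} -> env -> A) :
    c < b -> (forall j, dfun c (F j)) -> dfun b (fun v => F (v c) v).

Lemma dfun_le b c p : b <= c -> dfun b p -> dfun c p.
Proof.
move=> bc h; case: h bc => {b p} [b x _|b b' F b'b hF bc].
  exact: dfun_cst.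
by apply: dfun_read hF; exact: lt_le_trans bc.
Qed.

Lemma dfun_ext b p v w :
  dfun b p -> (forall c, c < b -> v c = w c) -> p v = p w.
Proof.
move=> h; elim: h => {b p} // b c F cb _ IH vw.
by rewrite vw //; apply: IH => c' c'c; apply: vw; exact: lt_trans cb.
Qed.

Lemma dfun_comp n (G : ('I_n -> A) -> A) b (p : 'I_n -> env -> A) :
  (forall i, dfun b (p i)) -> dfun b (fun v => G (fun i => p i v)).
Proof.
elim/(well_founded_ind wfO): b p => b IH p pb.
case: (pselect (forall i, exists x, p i = fun=> x)) => [/choice[x px]|].
  have -> : p = fun i => fun=> x i by apply: funext.
  exact: dfun_cst.
move=> /existsNP[i0 i0P].
have {i0P} [c0 c0b [F0 F0c p0]] : exists2 c, c < b & exists2 F,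
    (forall j, dfun c (F j)) & p i0 = fun v => F (v c) v.
  move: (pb i0) i0P => h; move Ep: (p i0) h => p0 h.
  case: h => {p0 Ep} [b' x []|b' c F cb hF _]; first by exists x.
  by exists c => //; exists F.
have /choice[s sP] : forall i, exists c, [/\ c < b, c0 <= c & exists2 F,
    (forall j, dfun c (F j)) & p i = fun v => F (v c) v].
  move=> i; move: (pb i) c0b; move Ep: (p i) => p' h.
  case: h => {p' Ep} [b' x c0b|b' c F cb hF c0b].
    by exists c0; split=> //; exists (fun=> fun=> x) => // j; exact: dfun_cst.
  case: (leP c0 c) => cc0; first by exists c; split=> //; exists F.
  exists c0; split=> //; exists (fun=> fun v => F (v c) v) => // j.
  exact: dfun_read hF.
pose m := [arg max_(i > i0) s i]%O.
have mP i : s i <= s m by rewrite /m; case: arg_maxP => // k _; exact.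
have mb : s m < b by case: (sP m).
have /choice[F FP] : forall i, exists F,
    (forall j, dfun (s m) (F j)) /\ p i = fun v => F (v (s m)) v.
  move=> i; have [_ _ [F hF pF]] := sP i.
  have := mP i; rewrite le_eqVlt => /orP[/eqP e|lt_im].
    by move: F hF pF; rewrite e => F hF pF; exists F.
  by exists (fun=> p i); split=> // j; rewrite pF; exact: dfun_read hF.
have -> : (fun v => G (fun i => p i v)) =
          fun v => (fun j v => G (fun i => F i j v)) (v (s m)) v.
  apply: funext => v /=; congr G; apply: funext => i.
  by rewrite {1}(FP i).2.
apply: (dfun_read (F := fun j v => G (fun i => F i j v))) => // j.
by apply: IH => // i; exact: (FP i).1.
Qed.

Lemma env_exists : exists v : env, True.
Proof.
have h b : exists j, I b j by have [j [_ [bj _ _]]] := I_gt1 b; exists j.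
by exists (fun b => cid (h b)).
Qed.

Definition dfun_structure (b : O) : structure sg :=
  @Structure sg {p : env -> A | dfun b p}
    (fun f p => exist _ (fun v => sfun A f (fun i => sval (p i) v))
                  (dfun_comp (sfun A f) (fun i => svalP (p i))))
    (fun R p => forall v, srel A R (fun i => sval (p i) v))
    (fun c => exist _ (fun=> scst A c) (dfun_cst b (scst A c))).

Definition dfun_emb b c (bc : b <= c) (p : dfun_structure b) :
    dfun_structure c := exist _ (sval p) (dfun_le bc (svalP p)).

Lemma dfun_eq b (p q : dfun_structure b) : sval p = sval q -> p = q.
Proof. by apply: eq_sig_hprop => ? ? ?; exact: Prop_irrelevance. Qed.

Lemma dfun_zero b : is_zero b -> isomorphic A (dfun_structure b).
Proof.
move=> bz; have [v0 _] := env_exists.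
exists (fun x => exist _ (fun=> x) (dfun_cst b x)); split.
- exists (fun p => sval p v0) => // -[p bp]; apply: dfun_eq => /=.
  apply: funext => v; apply: (dfun_ext bp) => c cb.
  by move: (bz c); rewrite leNgt cb.
- by move=> f x; exact: dfun_eq.
- by move=> R x; split=> //= /(_ v0).
- by move=> c; exact: dfun_eq.
Qed.

Lemma dfun_with b c (p : dfun_structure b) v (j : {j | I c j}) :
  b <= c -> sval p (dfwith v c j) = sval p v.
Proof.
move=> bc; apply: (dfun_ext (svalP p)) => c' c'b; rewrite dfwithout //.
by rewrite gt_eqF // (lt_le_trans c'b).
Qed.

Lemma dfun_succ b b' : is_succ b b' ->
  exists s : direct_power (dfun_structure b) {j | I b j} -> dfun_structure b',
    isomorphism s /\
    forall a (hab : a <= b) (hab' : a <= b') (x : dfun_structure a),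
      dfun_emb hab' x = s (fun _ => dfun_emb hab x).
Proof.
move=> bb'.
pose s (F : direct_power (dfun_structure b) {j | I b j}) : dfun_structure b' :=
  exist (dfun b') (fun v => sval (F (v b)) v)
    (dfun_read (F := fun j => sval (F j)) bb'.1 (fun j => svalP (F j))).
have sE F v j : sval (s F) (dfwith v b j) = sval (F j) v.
  by rewrite /= dfwithin dfun_with.
exists s; split; last by move=> a hab hab' x; exact: dfun_eq.
split.
- have /choice[t tP] : forall p : dfun_structure b',
      exists F : direct_power (dfun_structure b) {j | I b j}, s F = p.
    move=> [p bp]; suff [F Fp] : exists F : direct_power
        (dfun_structure b) {j | I b j}, (fun v => sval (F (v b)) v) = p.
      by exists F; exact: dfun_eq.
    case: bp bb' {s sE} => {b' p} [b' x _|b' c F cb' hF bb'].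
      by exists (fun=> exist _ _ (dfun_cst b x)).
    have := is_succ_lt bb' cb'; rewrite le_eqVlt => /orP[/eqP e|cb].
      by subst c; exists (fun j => exist _ _ (hF j)).
    by exists (fun=> exist _ _ (dfun_read cb hF)).
  exists t => [F|//]; apply: funext => j; apply: dfun_eq; apply: funext => v.
  by rewrite -(sE F) -(sE (t _)) tP.
- by move=> f x; exact: dfun_eq.
- move=> R x; split=> [h v|h j v]; first exact: h.
  have := h (dfwith v b j); congr (srel A R _).
  by apply: funext => i; rewrite sE.
- by move=> c; exact: dfun_eq.
Qed.

Lemma dfun_limit lam : is_limit lam ->
  is_direct_limit dfun_emb (fun a (ha : a < lam) => dfun_emb (ltW ha)).
Proof.
move=> [lnz lns].
have [b0 b0l] : exists b, b < lam.
  by move: lnz => /existsNP[b /negP]; rewrite -ltNge; exists b.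
have lower p : dfun lam p -> exists2 b, b < lam & dfun b p.
  move=> h; case: h lns b0l => {lnz lam p} [l x _ b0l|l c F cl hF lns _].
    by exists b0 => //; exact: dfun_cst.
  have [c' cc'] := succ_exists wfO cl; rewrite le_eqVlt => /orP[/eqP e|c'l].
    by case: lns; exists c; rewrite -e.
  by exists c' => //; exact: dfun_read cc'.1 hF.
have lowers n (p : 'I_n -> env -> A) : (forall i, dfun lam (p i)) ->
    exists2 b, b < lam & forall i, dfun b (p i).
  move=> hp; have /choice[s sP] : forall i, exists b, b < lam /\ dfun b (p i).
    by move=> i; have [b bl bp] := lower _ (hp i); exists b.
  exists (\big[Order.max/b0]_i s i).
    by elim/big_ind: _ => // [x y xl yl|i _]; rewrite ?gt_max ?xl //; case: (sP i).
  by move=> i; apply: dfun_le (sP i).2; exact: le_bigmax_cond.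
split.
  by split=> [a ha|a b ha hb hab x]; [split=> // *; exact: dfun_eq | exact: dfun_eq].
move=> T g [ghom gcoc].
have gE a b (ha : a < lam) (hb : b < lam) (x : dfun_structure a)
    (y : dfun_structure b) : sval x = sval y -> g a ha x = g b hb y.
  wlog ab : a b ha hb x y / a <= b => [W xy|xy].
    by case: (leP a b) => [|/ltW] ?; [|symmetry]; exact: W.
  by rewrite -(gcoc _ _ ha hb ab); congr g; exact: dfun_eq.
have /choice[h hP] : forall p : dfun_structure lam, exists y : T,
    forall a (ha : a < lam) (x : dfun_structure a), sval x = sval p ->
      y = g a ha x.
  move=> p; have [b bl bp] := lower _ (svalP p).
  by exists (g b bl (exist _ _ bp)) => a ha x xp; exact: gE.
exists h; split; last first.
  move=> h' [_ h'P]; apply: funext => p; have [b bl bp] := lower _ (svalP p).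
  rewrite (hP p b bl (exist _ _ bp)) // -h'P; congr h'; exact: dfun_eq.
split; last by move=> a ha x; exact: hP.
split.
- move=> f p; have [b bl bp] := lowers _ _ (fun i => svalP (p i)).
  pose p' i : dfun_structure b := exist _ _ (bp i).
  rewrite (hP _ b bl (sfun (dfun_structure b) f p')) //.
  have [-> _ _] := ghom b bl; congr (sfun T f _); apply: funext => i.
  by rewrite -(hP (p i)).
- move=> R p pR; have [b bl bp] := lowers _ _ (fun i => svalP (p i)).
  pose p' i : dfun_structure b := exist _ _ (bp i).
  have [_ /(_ R p' pR) + _] := ghom b bl; congr (srel T R _).
  by apply: funext => i; rewrite -(hP (p i)).
- move=> c; rewrite (hP _ b0 b0l (scst (dfun_structure b0) c)) //.
  by have [_ _ ->] := ghom b0 b0l.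
Qed.

Theorem direct_power_hierarchy_exists :
  inhabited (direct_power_hierarchy A I).
Proof.
split; apply: (@DirectPowerHierarchy sg d O A J I dfun_structure dfun_emb).
- by move=> a haa x; exact: dfun_eq.
- exact: dfun_zero.
- exact: dfun_succ.
- exact: dfun_limit.
Qed.

End DirectPowersExist.

(* Main.v *)
Require Import Defs.
From mathcomp Require Import all_boot all_order.
From mathcomp Require Import mathcomp_extra boolp classical_sets.

(* The iterated direct powers of [A] are realized by the functions [env -> A]
    of [dfun_structure], where an environment picks one index in each [I c].
    A set-like object [a] of the cumulative hierarchy denotes such a function
    too: evaluate [a] at an environment by reading one index at every level of
    nesting. Two objects are hereditarily identical iff they denote the same
    function, and the cumulative interpretations of the symbols are the
    pointwise ones on denotations; so the quotient at stage [b] is isomorphic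
    to [dfun_structure b]. It remains to see that the recursion clauses
    determine a direct power hierarchy up to isomorphism, which at limits is
    the universal property of direct limits. *)

Set Implicit Arguments.
Unset Strict Implicit.
Unset Printing Implicit Defensive.

Import Order.TTheory.
Local Open Scope order_scope.
Local Open Scope classical_set_scope.

(** * Isomorphisms *)

Section Isomorphisms.
Context {sg : signature}.
Implicit Types S T U : structure sg.

Lemma isomorphism_hom S T (h : S -> T) : isomorphism h -> homomorphism h.
Proof. by case=> _ hf hr hc; split=> // r x /hr. Qed.

Lemma id_hom S : homomorphism (fun x : S => x).
Proof. by []. Qed.

Lemma comp_hom S T U (h : S -> T) (g : T -> U) :
  homomorphism h -> homomorphism g -> homomorphism (fun x => g (h x)).
Proof.
move=> [hf hr hc] [gf gr gc]; split=> [f x|r x /hr/gr //|c].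
  by rewrite hf gf.
by rewrite hc gc.
Qed.

(** The inverse homomorphism carries relations back, so relations are reflected as well as
    preserved. *)
Lemma hom_isomorphism S T (h : S -> T) (g : T -> S) :
  homomorphism h -> homomorphism g -> cancel h g -> cancel g h ->
  isomorphism h.
Proof.
move=> [hf hr hc] [_ gr _] hg gh; split=> //; first by exists g.
move=> r x; split=> [|/gr]; first exact: hr.
by congr (srel S r _); apply: funext => i; rewrite hg.
Qed.

Lemma isomorphism_inv S T (h : S -> T) : isomorphism h ->
  exists g : T -> S, [/\ isomorphism g, cancel h g & cancel g h].
Proof.
move=> [[g hg gh] hf hr hc]; exists g; split=> //; split.
- by exists h.
- move=> f y; apply: (can_inj hg); rewrite gh hf.
  by congr (sfun T f _); apply: funext => i; rewrite gh.
- move=> r y; rewrite (hr r).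
  by have -> : (fun i => h (g (y i))) = y by apply: funext => i.
- by move=> c; apply: (can_inj hg); rewrite gh hc.
Qed.

Lemma comp_isomorphism S T U (h : S -> T) (g : T -> U) :
  isomorphism h -> isomorphism g -> isomorphism (fun x => g (h x)).
Proof.
move=> hI gI; have [h' [h'I hh' h'h]] := isomorphism_inv hI.
have [g' [g'I gg' g'g]] := isomorphism_inv gI.
apply: (hom_isomorphism (g := fun x => h' (g' x))) => [||x|x].
- exact: comp_hom (isomorphism_hom hI) (isomorphism_hom gI).
- exact: comp_hom (isomorphism_hom g'I) (isomorphism_hom h'I).
- by rewrite gg' hh'.
- by rewrite h'h g'g.
Qed.

Lemma direct_power_isomorphism S T K (h : S -> T) : isomorphism h ->
  isomorphism (S := direct_power S K) (T := direct_power T K)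
    (fun F k => h (F k)).
Proof.
move=> [[g hg gh] hf hr hc]; split.
- by exists (fun F k => g (F k)) => F; apply: funext => k; rewrite ?hg ?gh.
- by move=> f x; apply: funext => k /=; rewrite hf.
- by move=> r x; split=> H k; apply/hr; exact: H.
- by move=> c; apply: funext => k /=; rewrite hc.
Qed.

Lemma isomorphic_sym S T : isomorphic S T -> isomorphic T S.
Proof. by case=> h /isomorphism_inv[g [gI _ _]]; exists g. Qed.

Lemma isomorphic_trans S T U :
  isomorphic S T -> isomorphic T U -> isomorphic S U.
Proof. by move=> [h hI] [g gI]; eexists; exact: comp_isomorphism hI gI. Qed.

End Isomorphisms.

(** * Uniqueness of the direct power hierarchy *)

Section DirectLimits.
Context {sg : signature} {d : Order.disp_t} {O : orderType d}.
Variables (P : O -> structure sg) (e : forall a b : O, a <= b -> P a -> P b).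
Variables (lam : O) (L : structure sg) (c : forall a, a < lam -> P a -> L).

(** Both maps solve the universal problem for the cocone [h2] after [c]. *)
Lemma direct_limit_ext (T : structure sg) (h1 h2 : L -> T) :
  is_direct_limit e c ->
  homomorphism h1 -> homomorphism h2 ->
  (forall a (ha : a < lam) x, h1 (c ha x) = h2 (c ha x)) -> h1 = h2.
Proof.
move=> [[chom ccoc] cuniv] h1P h2P h12.
have [|h [_ hu]] := cuniv T (fun a ha x => h2 (c ha x)).
  split=> [a ha|a b ha hb hab x]; first exact: comp_hom.
  by rewrite (ccoc _ _ ha).
by rewrite -(hu h1) // (hu h2).
Qed.

(* The union of the images is a substructure, and the universal map into it,
   followed by the inclusion, has to be the identity. *)
Lemma direct_limit_surj : is_direct_limit e c -> is_limit lam ->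
  forall y : L, exists a (ha : a < lam) x, y = c ha x.
Proof.
move=> cL [lnz _]; have [[chom ccoc] cuniv] := cL.
pose im (y : L) := exists a (ha : a < lam) x, y = c ha x.
have [b0 b0l] : exists b, b < lam.
  by move: lnz => /existsNP[b /negP]; rewrite -ltNge; exists b.
have imf f (y : 'I_(farity f) -> {y | im y}) :
    im (sfun L f (fun i => sval (y i))).
  have /choice[s sP] : forall i, exists a, exists (ha : a < lam) x,
      sval (y i) = c ha x by move=> i; exact: (svalP (y i)).
  (* A common stage for the finitely many arguments; the default [b0] keeps it below [lam] when
     there are none. *)
  pose m := \big[Order.max/b0]_i s i.
  have ml : m < lam.
    rewrite /m; elim/big_ind: _ => // [? ? xl yl|i _]; first by rewrite gt_max xl.
    by have [sl _] := sP i.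
  have /choice[x xP] : forall i, exists x, sval (y i) = c ml x.
    move=> i; have [sl [x ->]] := sP i.
    have sm : s i <= m by exact: le_bigmax_cond.
    by exists (e sm x); rewrite (ccoc _ _ sl).
  exists m, ml, (sfun (P m) f x); have [-> _ _] := chom m ml.
  by congr (sfun L f _); apply: funext.
have imc k : im (scst L k).
  by exists b0, b0l, (scst (P b0) k); have [_ _ ->] := chom b0 b0l.
pose U := @Structure sg {y | im y} (fun f y => exist _ _ (imf f y))
  (fun r y => srel L r (fun i => sval (y i))) (fun k => exist _ _ (imc k)).
have Ueq (u v : U) : sval u = sval v -> u = v.
  by apply: eq_sig_hprop => ? ? ?; exact: Prop_irrelevance.
pose g a (ha : a < lam) (x : P a) : U :=
  exist im (c ha x) (ex_intro _ a (ex_intro _ ha (ex_intro _ x erefl))).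
have [|h [[hhom hg] _]] := cuniv U g.
  split=> [a ha|a b ha hb hab x]; last by apply: Ueq; exact: ccoc.
  have [cf cr cc] := chom a ha; split=> [f x|r x /cr //|k].
    by apply: Ueq; exact: cf.
  by apply: Ueq; exact: cc.
have sv_hom : homomorphism (fun u : U => sval u : L) by [].
have E : (fun y => sval (h y) : L) = id.
  apply: (direct_limit_ext cL (comp_hom hhom sv_hom) (id_hom L)) => a ha x.
  by rewrite hg.
by move=> y; rewrite -[y]/(id y) -E; exact: (svalP (h y)).
Qed.

End DirectLimits.

(** * Comparison of two hierarchies, stage by stage *)

Section HierarchyUnique.
Context {sg : signature} (A : structure sg).
Context {d : Order.disp_t} {O : orderType d} {J : Type} (I : O -> set J).
Hypothesis wfO : well_ordered O.

(** [dpow_zero] and [dpow_succ] assert existence only; the fixed choices [dzero] and [dsucc] allow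
    [corr] to name these isomorphisms. *)
Definition dzero (P : direct_power_hierarchy A I) b (bz : is_zero b) :
  A -> P b := sval (cid (dpow_zero P bz)).

Lemma dzeroP (P : direct_power_hierarchy A I) b (bz : is_zero b) :
  isomorphism (dzero P bz).
Proof. exact: (svalP (cid (dpow_zero P bz))). Qed.

Definition dsucc (P : direct_power_hierarchy A I) b b' (bb' : is_succ b b') :
  direct_power (P b) {j | I b j} -> P b' := sval (cid (dpow_succ P bb')).

Lemma dsucc_iso (P : direct_power_hierarchy A I) b b' (bb' : is_succ b b') :
  isomorphism (@dsucc P b b' bb').
Proof. by case: (svalP (cid (dpow_succ P bb'))). Qed.

Lemma demb_succ (P : direct_power_hierarchy A I) a b b' (bb' : is_succ b b')
    (ab : a <= b) (ab' : a <= b') (x : P a) :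
  demb ab' x = dsucc bb' (fun=> demb ab x).
Proof. by case: (svalP (cid (dpow_succ P bb'))) => _ ->. Qed.

Variables P Q : direct_power_hierarchy A I.

(** The graph of the comparison map, at all stages at once. A relation can be defined without
    knowing compatibility with [demb], whereas a map out of a limit stage cannot. *)
Inductive corr : forall b, P b -> Q b -> Prop :=
| corr_zero b (bz : is_zero b) x : corr (dzero P bz x) (dzero Q bz x)
| corr_succ b b' (bb' : is_succ b b') (F : direct_power (P b) {j | I b j})
    (G : direct_power (Q b) {j | I b j}) :
    (forall j, corr (F j) (G j)) -> corr (dsucc bb' F) (dsucc bb' G)
| corr_limit lam a (al : a < lam) x y : is_limit lam -> corr x y ->
    corr (demb (ltW al) x : P lam) (demb (ltW al) y : Q lam).

Lemma is_succ_not_zero (b b' : O) : is_succ b b' -> ~ is_zero b'.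
Proof. by move=> [bb' _] /(_ b); rewrite leNgt bb'. Qed.

Lemma is_succ_pred_inj (b c b' : O) : is_succ b b' -> is_succ c b' -> b = c.
Proof.
move=> bb' cb'; apply/eqP; rewrite eq_le.
by rewrite (is_succ_lt cb' bb'.1) (is_succ_lt bb' cb'.1).
Qed.

(** The three kinds of stage exclude one another, so the stage determines the constructor; any two
    proofs of its kind are equal, so the chosen isomorphisms match. *)
Lemma corr_zero_inv b (bz : is_zero b) (x : P b) (y : Q b) : corr x y ->
  exists a, x = dzero P bz a /\ y = dzero Q bz a.
Proof.
move=> h; case: h bz => {b x y}
  [b bz x bz'|b b' bb' F G _ bz|lam a al x y [nz _] _ bz].
- by rewrite (Prop_irrelevance bz' bz); exists x.
- by case: (is_succ_not_zero bb').
- by case: nz.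
Qed.

Lemma corr_succ_inv b b' (bb' : is_succ b b') (x : P b') (y : Q b') :
  corr x y -> exists F G,
    [/\ x = dsucc bb' F, y = dsucc bb' G & forall j, corr (F j) (G j)].
Proof.
move=> h; case: h bb' => {b' x y}
  [c bz x bb'|c b' cb' F G FG bb'|lam a al x y [_ nl] _ bl].
- by case: (is_succ_not_zero bb').
- have e := is_succ_pred_inj cb' bb'; subst c.
  by rewrite (Prop_irrelevance bb' cb'); exists F, G.
- by case: nl; exists b.
Qed.

Lemma corr_limit_inv lam (x : P lam) (y : Q lam) : is_limit lam -> corr x y ->
  exists a (al : a < lam) x' y',
    [/\ x = demb (ltW al) x', y = demb (ltW al) y' & corr x' y'].
Proof.
move=> + h; case: h => {lam x y} [b bz x|b b' bb' F G FG|lam a al x y _ xy _].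
- by case.
- by case=> _ []; exists b.
- by exists a, al, x, y.
Qed.

(** At a successor the embedding yields constant functions, handled coordinatewise; at a limit the
    claim is a constructor of [corr]. *)
Lemma corr_demb a b (ab : a <= b) (x : P a) (y : Q a) :
  corr x y -> corr (demb ab x) (demb ab y).
Proof.
move=> xy; elim/(well_founded_ind wfO): b ab => b IH ab.
have [e|ltab] : a = b \/ a < b.
  by move: ab; rewrite le_eqVlt => /orP[/eqP|]; [left|right].
  by subst b; rewrite !demb_id.
case: (ordinal_cases b) => [bz|[c cb]|bl].
- by move: (bz a); rewrite leNgt ltab.
- have ac := is_succ_lt cb ltab.
  rewrite !(demb_succ cb ac); apply: corr_succ => j; exact: IH cb.1 ac.
- by rewrite (Prop_irrelevance ab (ltW ltab)); exact: corr_limit.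
Qed.

(** Requiring the graph to be [corr] makes the isomorphisms at lower stages commute with [demb]; at
    a limit they then give cocones in both directions, whose induced maps are mutually inverse. *)
Lemma corr_isomorphism b : exists h : P b -> Q b,
  isomorphism h /\ forall x y, corr x y <-> h x = y.
Proof.
elim/(well_founded_ind wfO): b => b IH.
case: (ordinal_cases b) => [bz|[c cb]|bl].
- have [g [gI gK Kg]] := isomorphism_inv (dzeroP P bz).
  exists (fun x => dzero Q bz (g x)); split.
    exact: comp_isomorphism gI (dzeroP Q bz).
  move=> x y; split=> [/(corr_zero_inv bz)[a [-> ->]]|<-]; first by rewrite gK.
  by rewrite -{1}(Kg x); exact: corr_zero.
- have [h [hI hP]] := IH c cb.1.
  have [g [gI gK Kg]] := isomorphism_inv (dsucc_iso P cb).
  exists (fun x => dsucc cb (fun j => h (g x j))); split.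
    apply: comp_isomorphism (dsucc_iso Q cb).
    exact: comp_isomorphism gI (direct_power_isomorphism _ hI).
  move=> x y; split=> [/(corr_succ_inv cb)[F [G [-> -> FG]]]|<-].
    by rewrite gK; congr dsucc; apply: funext => j; apply/hP.
  by rewrite -{1}(Kg x); apply: corr_succ => j; apply/hP.
pose h a (al : a < b) : P a -> Q a := sval (cid (IH a al)).
have hI a al : isomorphism (h a al) by case: (svalP (cid (IH a al))).
have hP a al x y : corr x y <-> h a al x = y.
  by case: (svalP (cid (IH a al))) => _; apply.
have kP a al := cid (isomorphism_inv (hI a al)).
pose k a (al : a < b) : Q a -> P a := sval (kP a al).
have kI a al : isomorphism (k a al) by case: (svalP (kP a al)).
have hk a al : cancel (h a al) (k a al) by case: (svalP (kP a al)).
have kh a al : cancel (k a al) (h a al) by case: (svalP (kP a al)).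
have PL := dpow_limit P bl; have QL := dpow_limit Q bl.
have [[Phom Pcoc] Puniv] := PL; have [[Qhom Qcoc] Quniv] := QL.
have hE a a' (al : a < b) (a'l : a' < b) (aa' : a <= a') x :
    h a' a'l (demb aa' x) = demb aa' (h a al x).
  by apply/hP; apply: corr_demb; apply/hP.
have kE a a' (al : a < b) (a'l : a' < b) (aa' : a <= a') y :
    k a' a'l (demb aa' y) = demb aa' (k a al y).
  by apply: (can_inj (@hk _ a'l)); rewrite kh (hE _ _ al) kh.
have [|H [[Hhom HE] _]] :=
    Puniv (Q b) (fun a al x => demb (ltW al) (h a al x)).
  split=> [a al|a a' al a'l aa' x].
    exact: comp_hom (isomorphism_hom (hI a al)) (Qhom a al).
  by rewrite (hE _ _ al) Qcoc.
have [|K [[Khom KE] _]] :=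
    Quniv (P b) (fun a al y => demb (ltW al) (k a al y)).
  split=> [a al|a a' al a'l aa' y].
    exact: comp_hom (isomorphism_hom (kI a al)) (Phom a al).
  by rewrite (kE _ _ al) Pcoc.
have HK x : K (H x) = x.
  have E : (fun x => K (H x)) = id.
    apply: (direct_limit_ext PL (comp_hom Hhom Khom) (id_hom _)) => a al z.
    by rewrite HE KE hk.
  by rewrite -[RHS]/(id x) -E.
have KH y : H (K y) = y.
  have E : (fun y => H (K y)) = id.
    apply: (direct_limit_ext QL (comp_hom Khom Hhom) (id_hom _)) => a al z.
    by rewrite KE HE kh.
  by rewrite -[RHS]/(id y) -E.
exists H; split; first exact: hom_isomorphism Hhom Khom HK KH.
move=> x y; split=> [/(corr_limit_inv bl)[a [al [x' [y' [-> -> xy]]]]]|<-].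
  by rewrite HE; congr demb; apply/hP.
(* [corr] at a limit speaks only of elements coming from lower stages, so the stages have to cover
   the limit. *)
have [a [al [x' ->]]] := direct_limit_surj PL bl x.
by rewrite HE; apply: corr_limit => //; apply/hP.
Qed.

Theorem direct_power_hierarchy_unique b : isomorphic (P b) (Q b).
Proof. by have [h [hI _]] := corr_isomorphism b; exists h. Qed.

End HierarchyUnique.

(** * Denotations of the objects of the cumulative hierarchy *)

Section Denotation.
Context {sg : signature} (A : structure sg).
Context {d : Order.disp_t} {O : orderType d} {J : Type} (I : O -> set J).
Hypothesis wfO : well_ordered O.
Hypothesis I_gt1 : forall b, exists j k, [/\ I b j, I b k & j <> k].

Local Notation env := (forall b, {j | I b j}).
Local Notation pobj := (pobj A I).

(** On the hierarchy labels strictly decrease with nesting, so each index of [v] is read at most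
    once. A constant function denotes what its value denotes, which matches the embeddings of direct
    powers. *)
Fixpoint den (a : pobj) (v : env) : A :=
  match a with
  | Atom x => x
  | Fun b f => den (f (v b)) v
  end.

Lemma cum_den b a : cum b a -> dfun b (den a).
Proof.
elim=> {b a} [b x _|b b' f bb' _ IH|b b' a bb' _ IH|lam b a _ bl _ IH].
- exact: dfun_cst.
- exact: (dfun_read (F := fun j => den (f j)) bb'.1 IH).
- exact: dfun_le (ltW bb'.1) IH.
- exact: dfun_le (ltW bl) IH.
Qed.

(** A read at [c] becomes a function labelled [c]; it enters at the successor of [c], which is at
    most [b]. *)
Lemma dfun_den b p : dfun (A := A) (I := I) b p ->
  exists2 a, cum b a & den a = p.
Proof.
elim=> {b p} [b x|b c F cb _ IH].
  by exists (Atom I x) => //; exact: cum_Atom.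
have /choice[f fP] : forall j, exists a, cum c a /\ den a = F j.
  by move=> j; have [a ca aF] := IH j; exists a.
have [c' cc' c'b] := succ_exists wfO cb.
exists (Fun f).
  by apply: (cum_le wfO c'b); apply: cum_succ_fun cc' _ => j; exact: (fP j).1.
by apply: funext => v /=; rewrite (fP _).2.
Qed.

(** * Ranks and the coordinates [theta] *)

Lemma cum_rank b (a : pobj) : cum b a -> exists r, rank a r.
Proof.
move=> ab; have [|r ra rmin] := @ordinal_min _ _ wfO (fun c => cum c a).
  by exists b.
by exists r.
Qed.

Lemma rank_pred (a : pobj) r : rank a r -> ~ is_zero r ->
  exists c, is_succ c r.
Proof.
case: a => [x /(rank_Atom _ wfO) //|c f ar _].
have [r' cr' [_ fP]] := cum_Fun_inv ar.1.
by exists c; rewrite (rank_inj ar (rank_Fun cr' fP)).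
Qed.

Lemma rank_zero_Atom (a : pobj) r : rank a r -> is_zero r ->
  exists x, a = Atom I x.
Proof.
case: a => [x _ _|c f ar rz]; first by exists x.
have [r' cr' [r'r _]] := cum_Fun_inv ar.1.
by move: (lt_le_trans cr'.1 r'r); rewrite ltNge rz.
Qed.

Lemma theta_Fun c r (f : {j | I c j} -> pobj) (j : {j | I c j}) :
  rank (Fun f) r -> theta r (sval j) (Fun f) = f j.
Proof.
move=> fr /=; case: pselect => [_|[]]; last by exists r.
case: pselect => [cj|[]]; last exact: (svalP j).
by congr f; apply: eq_sig_hprop => // ? ? ?; exact: Prop_irrelevance.
Qed.

Lemma theta_lt al j (a : pobj) r : rank a r -> r < al -> theta al j a = a.
Proof.
case: a => //= b f fr ral; case: pselect => [[s sr als]|//].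
by move: als; rewrite (rank_inj sr fr) leNgt ral.
Qed.

(** If [s < r], [theta] changes nothing; if [s = r], the label of [a] is [c], and [den] itself
    starts by reading [v c]. *)
Lemma den_theta c r (a : pobj) s v : is_succ c r -> rank a s -> s <= r ->
  den (theta r (sval (v c)) a) v = den a v.
Proof.
move=> cr ras; rewrite le_eqVlt => /orP[/eqP e|sr]; last first.
  by rewrite (theta_lt _ ras sr).
subst s; case: a ras => [//|b f] fr.
have [r' br' [_ fP]] := cum_Fun_inv fr.1.
have e := rank_inj fr (rank_Fun br' fP); subst r'.
by have e := is_succ_pred_inj br' cr; subst b; rewrite theta_Fun.
Qed.

(** The coordinate lies in stage [c], so its denotation ignores the index at [c], which may be set
    to [j]. *)
Lemma den_theta_with c r (a : pobj) s (j : {j | I c j}) v :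
  is_succ c r -> rank a s -> s <= r ->
  den (theta r (sval j) a) v = den a (dfwith v c j).
Proof.
move=> cr ras sr; rewrite -(den_theta _ cr ras sr) dfwithin.
apply: (dfun_ext (cum_den (theta_cum wfO j cr ras sr))) => c' c'c.
by rewrite dfwithout // gt_eqF.
Qed.

Lemma den_Atom_inj x y : den (Atom I x) = den (Atom I y) -> x = y.
Proof.
by have [v _] := env_exists I_gt1 => /(congr1 (fun p => p v)).
Qed.

(** * Hereditary identity as equality of denotations *)

Lemma hid_cum b a1 a2 : hid b a1 a2 -> cum (A := A) (I := I) b a1 /\ cum b a2.
Proof.
elim=> {b a1 a2} // [b b' z a _ zz [za _]|lam b a1 a2 _ bl _ [h1 h2]].
  by split; apply: (cum_le wfO (zz b')).
by split; apply: (cum_le wfO (ltW bl)).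
Qed.

Lemma hid_den b a1 a2 : hid (A := A) (I := I) b a1 a2 -> den a1 = den a2.
Proof.
elim=> {b a1 a2} // b b' c ra rb a1 a2 _ _ _ ar1 ar2 cm _ IH.
apply: funext => v.
rewrite -(den_theta _ cm ar1) ?le_max ?lexx // IH.
by rewrite (den_theta _ cm ar2) // le_max lexx orbT.
Qed.

Lemma den_hid b a1 a2 : cum b a1 -> cum b a2 -> den a1 = den a2 ->
  hid b a1 a2.
Proof.
elim/(well_founded_ind wfO): b a1 a2 => b IH a1 a2 h1 h2 E.
have [r1 ar1] := cum_rank h1; have [r2 ar2] := cum_rank h2.
case: (ordinal_cases b) => [bz|[b' bb']|bl].
- have e1 : r1 = b by apply/eqP; rewrite eq_le bz ar1.2.
  have e2 : r2 = b by apply/eqP; rewrite eq_le bz ar2.2.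
  subst r1 r2; have [x ex] := rank_zero_Atom ar1 bz.
  have [y ey] := rank_zero_Atom ar2 bz; subst a1 a2.
  by rewrite (den_Atom_inj E); apply: hid_zero bz _; exact: cum_Atom.
- case: (pselect (is_zero (Order.max r1 r2))) => [mz|mnz].
    have z1 : is_zero r1.
      by move=> c; apply: le_trans (mz c); rewrite le_max lexx.
    have z2 : is_zero r2.
      by move=> c; apply: le_trans (mz c); rewrite le_max lexx orbT.
    have [x ex] := rank_zero_Atom ar1 z1.
    have [y ey] := rank_zero_Atom ar2 z2; subst a1 a2.
    by rewrite (den_Atom_inj E); exact: hid_succ_zero bb' z2 ar2.
  have [c cm] : exists c, is_succ c (Order.max r1 r2).
    by case: (leP r1 r2) mnz => _; [exact: rank_pred ar2 | exact: rank_pred ar1].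
  have le1 : r1 <= Order.max r1 r2 by rewrite le_max lexx.
  have le2 : r2 <= Order.max r1 r2 by rewrite le_max lexx orbT.
  (* Induction is used at [c], the predecessor of the maximal rank, which may lie below [b']. *)
  apply: (hid_succ_pos bb' h1 h2 ar1 ar2 cm) => j; apply: IH.
  + apply: (lt_le_trans cm.1); rewrite ge_max.
    by rewrite (ar1.2 _ h1) (ar2.2 _ h2).
  + exact: theta_cum cm ar1 le1.
  + exact: theta_cum cm ar2 le2.
  + apply: funext => v; rewrite (den_theta_with _ _ cm ar1 le1).
    by rewrite (den_theta_with _ _ cm ar2 le2) E.
(* A nonzero rank is a successor, so no rank equals the limit [b], and both objects already live at
   a lower stage. *)
- have lower (a : pobj) r : rank a r -> cum b a -> r < b.
    move=> ar ab; rewrite lt_neqAle ar.2 // andbT; apply/eqP => e; subst r.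
    by have [c cb] := rank_pred ar bl.1; case: bl.2; exists c.
  have ml : Order.max r1 r2 < b.
    by rewrite gt_max (lower _ _ ar1 h1) (lower _ _ ar2 h2).
  apply: (hid_limit bl ml); apply: IH => //.
    by apply: (cum_le wfO _ ar1.1); rewrite le_max lexx.
  by apply: (cum_le wfO _ ar2.1); rewrite le_max lexx orbT.
Qed.

(** * Function and relation symbols act pointwise on denotations *)

Lemma cum_fun_den f b a a' v : cum_fun (A := A) (I := I) (f := f) b a a' ->
  den a' v = sfun A f (fun i => den (a i) v).
Proof.
elim=> {b a a'} // b c r a g _ [ar _] cr _ _ IH /=.
rewrite IH; congr (sfun A f _); apply: funext => i.
by have [s as_ sr] := ar i; exact: den_theta as_ sr.
Qed.

Lemma cum_rel_den R b a v : cum_rel (A := A) (I := I) (R := R) b a ->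
  srel A R (fun i => den (a i) v).
Proof.
elim=> {b a} // b c r a _ [ar _] cr _ /(_ (v c)).
congr (srel A R _); apply: funext => i.
by have [s as_ sr] := ar i; exact: den_theta as_ sr.
Qed.

Lemma max_rank_cases n b (a : 'I_n -> pobj) : (forall i, cum b (a i)) ->
  (exists x, a = fun i => Atom I (x i)) \/
  exists c r, [/\ max_rank a r, is_succ c r & r <= b].
Proof.
move=> ab; case: (pselect (forall i, exists x, a i = Atom I x)).
  by move=> /choice[x ax]; left; exists x; apply: funext.
move=> /existsNP[i0 i0P]; right.
have /choice[s sP] : forall i, exists s, rank (a i) s.
  by move=> i; exact: cum_rank (ab i).
(* The non-atom [i0] provides an index to maximize over and forces the maximum to be positive. *)
pose m := [arg max_(i > i0) s i]%O.
have mP i : s i <= s m by rewrite /m; case: arg_maxP => // k _; exact.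
have [c cm] : exists c, is_succ c (s m).
  apply: (rank_pred (sP m)) => mz; apply: i0P.
  by apply: (rank_zero_Atom (sP i0)) => c; exact: le_trans (mP i0) (mz c).
exists c, (s m); split=> //; last exact: (sP m).2.
by split; [move=> i; exists (s i) | exists m].
Qed.

(** Coordinates at [j] denote values at environments with [j] at [c], so the pointwise hypothesis
    passes to them and induction applies at [c < b]. *)
Lemma den_cum_rel R b (a : 'I_(rarity R) -> pobj) : (forall i, cum b (a i)) ->
  (forall v, srel A R (fun i => den (a i) v)) -> cum_rel b a.
Proof.
elim/(well_founded_ind wfO): b a => b IH a ab aR.
case: (max_rank_cases ab) => [[x ax]|[c [r [ar cr rb]]]].
  subst a; apply: cum_rel_zero.
  by have [v _] := env_exists I_gt1; exact: aR v.
apply: (cum_rel_pos ab ar cr) => j; apply: IH => [|i|v].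
- exact: lt_le_trans cr.1 rb.
- by have [s as_ sr] := ar.1 i; exact: theta_cum cr as_ sr.
- have := aR (dfwith v c j); congr (srel A R _); apply: funext => i.
  by have [s as_ sr] := ar.1 i; rewrite (den_theta_with _ _ cr as_ sr).
Qed.

(** * The quotient structure as a structure of denotations *)

Lemma hid_classE b a : cum b a ->
  hid_class b a = [set a' | cum b a' /\ den a = den a'].
Proof.
move=> ab; apply/seteqP; split=> a' /=.
  by move=> h; split; [case: (hid_cum h) | exact: hid_den h].
by move=> [a'b E]; exact: den_hid.
Qed.

Lemma quot_reprE b (q : cum_quot A I b) : sval q = hid_class b (quot_repr q).
Proof. exact: (s2valP' (cid2 (svalP q))). Qed.

(** The chosen representative may differ from [a], but it lies in the class of [a], on which [den]
    is constant. *)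
Lemma den_repr b a (ab : cum b a) : den (quot_repr (to_quot ab)) = den a.
Proof.
apply: esym; apply: (@hid_den b); have := quot_reprE (to_quot ab); rewrite /= => E.
have : hid_class b (quot_repr (to_quot ab)) (quot_repr (to_quot ab)).
  by apply: den_hid => //; exact: cum_quot_repr.
by rewrite -E.
Qed.

Lemma cum_dfun_isomorphic b :
  isomorphic (cum_structure A I wfO b) (dfun_structure A I wfO b).
Proof.
pose h (q : cum_structure A I wfO b) : dfun_structure A I wfO b :=
  exist _ (den (quot_repr q)) (cum_den (cum_quot_repr q)).
have /choice[g gP] : forall p : dfun_structure A I wfO b, exists q, h q = p.
  move=> [p bp]; have [a ab ap] := dfun_den bp.
  by exists (to_quot ab); apply: dfun_eq; rewrite /= -ap; exact: den_repr.
have h_inj : injective h.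
  move=> q q' /(congr1 sval) /= E; apply: eq_sig_hprop.
    by move=> ? ? ?; exact: Prop_irrelevance.
  by rewrite !quot_reprE !hid_classE ?E //; exact: cum_quot_repr.
exists h; split.
- by exists g => // q; apply: h_inj; rewrite gP.
- move=> f q; apply: dfun_eq; apply: funext => v /=.
  by rewrite den_repr; exact: cum_fun_den (s2valP' (cum_fun_val wfO q)).
- move=> R q; split=> [[a aq aR] v|qR].
    (* The relation may be witnessed by arbitrary representatives [a]; they have the denotations of
       the chosen ones. *)
    have := cum_rel_den v aR; congr (srel A R _); apply: funext => i.
    by have := aq i; rewrite quot_reprE => /hid_den /= ->.
  exists (fun i => quot_repr (q i)).
    move=> i; rewrite quot_reprE; apply: den_hid => //; exact: cum_quot_repr.
  by apply: den_cum_rel qR => i; exact: cum_quot_repr.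
- by move=> c; apply: dfun_eq; apply: funext => v /=; rewrite den_repr.
Qed.

(** [direct_power_hierarchy_exists] hides the stages; here they are [dfun_structure] by
    computation. *)
Definition dfun_hierarchy : direct_power_hierarchy A I :=
  @DirectPowerHierarchy sg d O A J I (dfun_structure A I wfO)
    (@dfun_emb _ A _ _ _ I wfO)
    (fun a haa x => @dfun_eq _ A _ _ _ I wfO a (dfun_emb haa x) x erefl)
    (dfun_zero A wfO I_gt1) (dfun_succ A I wfO) (dfun_limit A I wfO).

End Denotation.

Theorem theorem3p6 (sg : signature) (A : structure sg)
    (d : Order.disp_t) (O : orderType d) (wfO : well_ordered O)
    (J : Type) (I : O -> set J)
    (I_gt1 : forall b : O, exists j k : J, [/\ I b j, I b k & j <> k])
    (Pi : direct_power_hierarchy A I) (b : O) :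
  isomorphic (Pi b) (cum_structure A I wfO b).
Proof.
apply: (isomorphic_trans (T := dfun_structure A I wfO b)).
  exact: (direct_power_hierarchy_unique wfO Pi (dfun_hierarchy A wfO I_gt1)).
exact/isomorphic_sym/cum_dfun_isomorphic.
Qed.
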